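(* Let $M:\mathcal{C}\to\mathbb{R}$ be any confusion matrix measure (CMM) and let $\hat Y$ be any stochastic classifier on $\mathcal{X}$. Then there is a regression-thresholding classifier (RTC) $\hat Y_{p,t,\eta}$, for some $p,t\in[0,1]$ and $\eta:\mathcal{X}\to[0,1]$, such that $$M(C_{\hat Y_{p,t,\eta}})\ \ge\ M(C_{\hat Y}).$$ In particular, if $\hat Y\mapsto M(C_{\hat Y})$ attains its maximum over all stochastic classifiers, then this maximum is attained by an RTC.
   Context: $(\mathcal{X},\rho)$ is a separable metric space and $(X,Y)$ has an arbitrary joint distribution $P_{X,Y}$ on $\mathcal{X}\times\{0,1\}$. The true regression function is $\eta^*(x)=\mathbb{P}[Y=1\mid X=x]$. A stochastic classifier is a map $\hat Y$ assigning to each $x\in\mathcal{X}$ a Bernoulli random variable $\hat Y(x)$, where $\mathbb{E}[\hat Y(x)]\in[0,1]$ is the probability that $x$ is assigned to class $1$; the randomness of the classifier is independent of the data, and $x\mapsto\mathbb{E}[\hat Y(x)]$ is measurable. $\mathcal{C}=\{C\in[0,1]^{2\times2}: C_{1,1}+C_{1,2}+C_{2,1}+C_{2,2}=1\}$ is the set of binary confusion matrices. The confusion matrix of $\hat Y$ is $$C_{\hat Y}=\begin{bmatrix}\mathrm{TN}_{\hat Y}&\mathrm{FP}_{\hat Y}\\ \mathrm{FN}_{\hat Y}&\mathrm{TP}_{\hat Y}\end{bmatrix},$$ with $\mathrm{TP}_{\hat Y}=\mathbb{E}[\eta^*(X)\hat Y(X)]$, $\mathrm{FN}_{\hat Y}=\mathbb{E}[\eta^*(X)(1-\hat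 Y(X))]$, $\mathrm{FP}_{\hat Y}=\mathbb{E}[(1-\eta^*(X))\hat Y(X)]$, $\mathrm{TN}_{\hat Y}=\mathbb{E}[(1-\eta^*(X))(1-\hat Y(X))]$, the expectations being over both the data and the classifier's randomness. A function $M:\mathcal{C}\to\mathbb{R}$ is a confusion matrix measure (CMM) if for every $C=\begin{bmatrix}\mathrm{TN}&\mathrm{FP}\\ \mathrm{FN}&\mathrm{TP}\end{bmatrix}\in\mathcal{C}$, every $\epsilon_1\in[0,\mathrm{FP}]$ and every $\epsilon_2\in[0,\mathrm{FN}]$, $$M(C)\le M\left(\begin{bmatrix}\mathrm{TN}+\epsilon_1&\mathrm{FP}-\epsilon_1\\ \mathrm{FN}-\epsilon_2&\mathrm{TP}+\epsilon_2\end{bmatrix}\right).$$ For $p,t\in[0,1]$ and $\eta:\mathcal{X}\to[0,1]$ measurable, the regression-thresholding classifier (RTC) $\hat Y_{p,t,\eta}$ is the stochastic classifier with $\hat Y_{p,t,\eta}(x)\sim\mathrm{Bernoulli}(p\cdot 1\{\eta(x)=t\}+1\{\eta(x)>t\})$ for all $x\in\mathcal{X}$. *)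

(* Defs.v *)
From HB Require Import structures.
From mathcomp Require Import all_boot all_order all_algebra.
From mathcomp Require Import all_classical all_reals all_analysis.

Set Implicit Arguments.
Unset Strict Implicit.
Unset Printing Implicit Defensive.

Import Order.TTheory GRing.Theory Num.Theory.
Import numFieldNormedType.Exports.

Local Open Scope classical_set_scope.
Local Open Scope ring_scope.

(* Measurable types are pointed in the library. A base point costs nothing here:
   a space that carries a probability measure is nonempty. *)
#[short(type="pointedMetricType")]
HB.structure Definition PointedMetric (R : numDomainType) :=
  {T of Pointed T & Metric R T}.

Definition separable (T : topologicalType) : Prop :=
  exists2 D : set T, countable D & dense D.

Notation borel T := (g_sigma_algebraType (@open T)).

(* [eta] is a [0, 1]-valued version of x |-> P[Y = 1 | X = x], where (X, Y) are
   the two coordinates under [P] and the label 1 is [true]. *)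
Definition regression_function {d : measure_display} {X : measurableType d}
    {R : realType} (P : probability (X * bool)%type R) (eta : X -> R) : Prop :=
  [/\ measurable_fun setT eta,
      forall x, 0 <= eta x <= 1 &
      forall A : set X, measurable A ->
        (\int[P]_(z in A `*` setT) (eta z.1)%:E = P (A `*` [set true]))%E].

(* All the labels live on one probability space, which belongs to the
   classifier and is separate from the one of the data; no joint measurability
   in (x, omega) is required. *)
Record stochastic_classifier {d : measure_display} (X : measurableType d)
    (R : realType) := StochasticClassifier {
  sc_display : measure_display;
  sc_space : measurableType sc_display;
  sc_prob : probability sc_space R;
  sc_label :> X -> {RV sc_prob >-> bool};
  sc_mean_measurable : measurable_fun setT
    (fun x => fine 'E_sc_prob[fun w => (sc_label x w)%:R])
}.

Section confusion.
Context {d : measure_display} {X : measurableType d} {R : realType}.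

(* E[f(X, Yhat(X))] over the data and the independent randomness of the
   classifier, the latter being integrated first. *)
Definition classifier_expectation (P : probability (X * bool)%type R)
    (Yhat : stochastic_classifier X R) (f : X -> R -> R) : R :=
  fine 'E_P[fun z => fine 'E_(sc_prob Yhat)[fun w => f z.1 (Yhat z.1 w)%:R]].

Definition confusion_mx (TN FP FN TP : R) : 'M[R]_2 :=
  \matrix_(i < 2, j < 2)
    if i == 0 then (if j == 0 then TN else FP)
    else (if j == 0 then FN else TP).

Definition is_confusion (C : 'M[R]_2) : Prop :=
  (forall i j, 0 <= C i j <= 1) /\ C 0 0 + C 0 1 + C 1 0 + C 1 1 = 1.

Definition confusion_of (P : probability (X * bool)%type R) (etastar : X -> R)
    (Yhat : stochastic_classifier X R) : 'M[R]_2 :=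
  let E := classifier_expectation P Yhat in
  confusion_mx
    (E (fun x y => (1 - etastar x) * (1 - y))) (E (fun x y => (1 - etastar x) * y))
    (E (fun x y => etastar x * (1 - y)))       (E (fun x y => etastar x * y)).

(* [M] is only constrained on confusion matrices; its values elsewhere are
   irrelevant. *)
Definition CMM (M : 'M[R]_2 -> R) : Prop :=
  forall TN FP FN TP : R, is_confusion (confusion_mx TN FP FN TP) ->
  forall e1 e2 : R, 0 <= e1 <= FP -> 0 <= e2 <= FN ->
  M (confusion_mx TN FP FN TP) <=
  M (confusion_mx (TN + e1) (FP - e1) (FN - e2) (TP + e2)).

Definition has_RTC_law (p t : R) (eta : X -> R)
    (Yhat : stochastic_classifier X R) : Prop :=
  forall x : X, distribution (sc_prob Yhat) (Yhat x) =1
    bernoulli_prob (p * (eta x == t)%:R + (t < eta x)%R%:R).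

Definition is_RTC (Yhat : stochastic_classifier X R) : Prop :=
  exists (p t : R) (eta : X -> R),
    [/\ 0 <= p <= 1, 0 <= t <= 1, measurable_fun setT eta,
        forall x, 0 <= eta x <= 1 & has_RTC_law p t eta Yhat].

End confusion.

(* Main.v *)
Require Import Defs.
From HB Require Import structures.
From mathcomp Require Import all_boot all_order all_algebra.
From mathcomp Require Import all_classical all_reals all_analysis.
From mathcomp Require Import measurable_realfun ring lra.
Import Order.TTheory GRing.Theory Num.Theory.
Import numFieldNormedType.Exports.
Local Open Scope classical_set_scope.
Local Open Scope ring_scope.

Set Implicit Arguments.
Unset Strict Implicit.

(** The confusion matrix of a stochastic classifier depends on the classifier
    only through its mean function h(x) = E[Yhat(x)], and its row sums are
    fixed: TP + FN = E[eta*(X)] and TN + FP = E[1 - eta*(X)]. A classifier is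
    therefore described by TP and by its rate of positive predictions
    TP + FP = E[h(X)].

    Fix that rate q = E[h(X)] and threshold eta* itself. A quantile t of
    eta*(X) satisfies P(eta* > t) <= q <= P(eta* >= t), so randomizing on the
    event eta* = t with a suitable probability p gives a thresholding
    classifier whose rate is exactly q ([exists_threshold01]). As in the
    Neyman-Pearson lemma, (eta* - t)(h' - h) >= 0 pointwise, where h' is the
    mean of the new classifier; integrating, with E[h'] = E[h], shows that TP
    does not decrease ([neyman_pearson]). Since TP + FP is unchanged, FP drops
    by the same amount, and the row sums give the corresponding moves of FN and
    TN. That is exactly a change for which a confusion matrix measure cannot
    decrease ([CMM_le]). *)

(** * Integrals of [0, 1]-valued functions *)

Section unit_interval_integrals.
Context {d : measure_display} {T : measurableType d} {R : realType}.
Variable P : probability T R.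
Implicit Types f g : T -> R.

Lemma fine_expectationE f : fine 'E_P[f] = \int[P]_x f x.
Proof. by rewrite unlock. Qed.

Lemma Rintegral_cst_probability (r : R) : \int[P]_x r = r.
Proof. by rewrite -fine_expectationE (expectation_cst P r). Qed.

Lemma integrable01 f : measurable_fun setT f -> (forall x, 0 <= f x <= 1) ->
  P.-integrable setT (EFin \o f).
Proof.
move=> mf f01; apply: measurable_bounded_integrable => //.
  by rewrite (le_lt_trans (probability_le1 P _))// ltry.
exists 1; split=> // M M1 x _ /=; have /andP[f0 f1] := f01 x.
by rewrite ger0_norm// (le_trans f1)// ltW.
Qed.

Lemma integrable_scale (k : R) f : P.-integrable setT (EFin \o f) ->
  P.-integrable setT (EFin \o (fun x => k * f x)).
Proof.
move=> fi; rewrite (_ : _ \o _ = fun x => k%:E * (EFin \o f) x)%E//.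
exact: integrableZl.
Qed.

Lemma integrable_add f g :
  P.-integrable setT (EFin \o f) -> P.-integrable setT (EFin \o g) ->
  P.-integrable setT (EFin \o (fun x => f x + g x)).
Proof.
move=> fi gi; rewrite (_ : _ \o _ = (EFin \o f) \+ (EFin \o g))%E//.
exact: integrableD.
Qed.

Lemma integrable01M f g :
  measurable_fun setT f -> (forall x, 0 <= f x <= 1) ->
  measurable_fun setT g -> (forall x, 0 <= g x <= 1) ->
  P.-integrable setT (EFin \o (fun x => f x * g x)).
Proof.
move=> mf f01 mg g01; apply: integrable01; first exact: measurable_funM.
by move=> x; have := f01 x; have := g01 x; nra.
Qed.

Lemma Rintegral01 f : measurable_fun setT f -> (forall x, 0 <= f x <= 1) ->
  0 <= \int[P]_x f x <= 1.
Proof.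
move=> mf f01; apply/andP; split.
  by apply: Rintegral_ge0 => x _; case/andP: (f01 x).
rewrite -[leRHS](Rintegral_cst_probability 1).
apply: le_Rintegral => //; first exact: integrable01.
  by apply: integrable01 => // x; rewrite lexx ler01.
by move=> x _; case/andP: (f01 x).
Qed.

Lemma Rintegral_mul_complement f g :
  measurable_fun setT f -> (forall x, 0 <= f x <= 1) ->
  measurable_fun setT g -> (forall x, 0 <= g x <= 1) ->
  \int[P]_x (f x * g x) + \int[P]_x ((1 - f x) * g x) = \int[P]_x g x.
Proof.
move=> mf f01 mg g01; rewrite -RintegralD//.
- by apply: eq_Rintegral => x _; ring.
- exact: integrable01M.
- apply: integrable01M => //; first exact: measurable_funB.
  by move=> x; have := f01 x; lra.
Qed.

End unit_interval_integrals.

(** * Thresholds with a prescribed rate of positive predictions *)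

Section thresholds.
Context {d : measure_display} {T : measurableType d} {R : realType}.
Variable P : probability T R.

Lemma ccdfE (X : {RV P >-> R}) (t : R) : ccdf X t = P [set x | t < X x].
Proof.
rewrite /ccdf /distribution /pushforward; congr (P _).
by apply/seteqP; split => x /=; rewrite in_itv/= andbT.
Qed.

Lemma ccdf_le_right (X : {RV P >-> R}) (t : R) (q : \bar R) :
  (forall s, t < s -> (ccdf X s <= q)%E) -> (ccdf X t <= q)%E.
Proof.
move=> Xq.
have Xt : ccdf X s @[s --> t^'+] --> ccdf X t by exact: ccdf_right_continuous.
apply: (cvge_to_le Xt); near=> s; apply: Xq; near: s; exact: nbhs_right_gt.
Unshelve. all: by end_near. Qed.

(** The quantile is the infimum of the s >= 0 with P(X > s) <= q. The upper
    tail at the infimum is controlled by right continuity of s |-> P(X > s);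
    the lower tail P(X < t) = P(- X > - t) by the same property for - X. *)
Lemma exists_quantile01 (X : {RV P >-> R}) (q : R) :
  (forall x, 0 <= X x <= 1) -> 0 <= q <= 1 ->
  exists2 t : R, 0 <= t <= 1 &
    (P [set x | (t < X x)%R] <= q%:E <= P [set x | (t <= X x)%R])%E.
Proof.
move=> X01 /andP[q0 q1].
pose S := [set s : R | 0 <= s /\ (ccdf X s <= q%:E)%E].
have S1 : S 1.
  split=> //; rewrite ccdfE (_ : [set _ | _] = set0) ?measure0//.
  apply/seteqP; split=> x //=; have /andP[_ ] := X01 x.
  by rewrite leNgt => /negP.
have S_lb : has_lbound S by exists 0 => s [].
have S_neq0 : S !=set0 by exists 1.
have t0 : 0 <= inf S by apply: lb_le_inf => // s [].
exists (inf S).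
  by rewrite t0/=; exact: ge_inf.
apply/andP; split.
  rewrite -ccdfE; apply: ccdf_le_right => s ts.
  have [u [_ uq] us] := inf_lt S_neq0 ts.
  by apply: le_trans uq; exact/ccdf_nonincreasing/ltW.
have geE : [set x | inf S <= X x] =
    ~` [set x | - inf S < (- X : {mfun T >-> R}) x].
  by apply/seteqP; split=> x /=; rewrite ltrN2 leNgt => /negP.
have mlt : measurable [set x | - inf S < (- X : {mfun T >-> R}) x].
  by rewrite -preimage_itvoy; exact: measurable_funPTI.
rewrite geE probability_setC// leeBrDr ?fin_num_measure//.
rewrite addeC -leeBrDr// -ccdfE; apply: ccdf_le_right => s.
rewrite ltrNl => sS.
(* Below 0 the failure of [S (- s)] says nothing, but then P(X < - s) = 0. *)
have [s0|s0] := ltP (- s) 0.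
  rewrite ccdfE (_ : [set _ | _] = set0).
    by rewrite measure0 -EFinB lee_fin subr_ge0.
  apply/seteqP; split=> x //=; have /andP[X0 _] := X01 x.
  by rewrite ltrNr => /(le_lt_trans X0)/(lt_trans s0); rewrite ltxx.
have qs : (q%:E <= ccdf X (- s))%E.
  rewrite leNgt; apply/negP => /ltW sq.
  have : inf S <= - s by exact: ge_inf.
  by rewrite leNgt sS.
rewrite leeBrDr// (le_trans (leeD2l _ qs))// -(cdf_ccdf_1 X (- s)) leeD2r//.
rewrite ccdfE /cdf /distribution /pushforward.
apply: le_measure; rewrite ?inE.
- by rewrite -preimage_itvoy; exact: measurable_funPTI.
- exact: measurable_funPTI.
- by move=> x /=; rewrite in_itv/= ltrNr => /ltW.
Qed.

(** An atom of g at the quantile is split by the randomization p, so that every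
    value of q is reached exactly. *)
Lemma exists_threshold01 (g : T -> R) (q : R) :
  measurable_fun setT g -> (forall x, 0 <= g x <= 1) -> 0 <= q <= 1 ->
  exists p t : R, [/\ 0 <= p <= 1, 0 <= t <= 1 &
    \int[P]_x (p * (g x == t)%:R + (t < g x)%R%:R) = q].
Proof.
move=> mg g01 q01.
pose X : {RV P >-> R} := mfun_Sub (mem_set mg).
have [t t01] := exists_quantile01 (X := X) g01 q01.
set A := [set x | t < X x]; set B := [set x | t <= X x].
have mA : measurable A by rewrite /A -preimage_itvoy; exact: measurable_funPTI.
have mB : measurable B by rewrite /B -preimage_itvcy; exact: measurable_funPTI.
rewrite -[P A]fineK ?fin_num_measure// -[P B]fineK ?fin_num_measure//.
rewrite !lee_fin => /andP[Aq qB].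
(* If P(g = t) = 0 then q = P(g > t) and the quotient is 0 by convention. *)
exists ((q - fine (P A)) / (fine (P B) - fine (P A))), t; split => //.
  have [AB|AB] := eqVneq (fine (P B) - fine (P A)) 0.
    by rewrite AB invr0 mulr0 lexx ler01.
  have AB0 : 0 < fine (P B) - fine (P A).
    by rewrite lt_def AB subr_ge0 (le_trans Aq).
  apply/andP; split; first by rewrite divr_ge0 ?subr_ge0// (le_trans Aq).
  by rewrite ler_pdivrMr// mul1r lerB.
set p := _ / _.
have AE x : (x \in A) = (t < X x) by apply/idP/idP; rewrite inE.
have BE x : (x \in B) = (t <= X x) by apply/idP/idP; rewrite inE.
transitivity (\int[P]_x ((1 - p) * \1_A x + p * \1_B x)).
  apply: eq_Rintegral => x _; rewrite !indicE AE BE /X/=.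
  by case: (ltgtP (g x) t) => _ /=; ring.
have iA := integrable_indic P mA; have iB := integrable_indic P mB.
rewrite RintegralD ?RintegralZl//; last 2 first.
- exact: integrable_scale.
- exact: integrable_scale.
rewrite /Rintegral !integral_indic// !setIT /p.
have [AB|AB] := eqVneq (fine (P B) - fine (P A)) 0.
  by have := subr0_eq AB; rewrite AB invr0; lra.
by field; exact: AB.
Qed.

(** Both sides of the desired inequality, once t * E[h] = t * E[h'] is added
    crosswise, are the integrals of the two sides of
    a h + t h' <= a h' + t h, which is (a - t)(h' - h) >= 0. *)
Lemma neyman_pearson (a h h' : T -> R) (t : R) :
  measurable_fun setT a -> (forall x, 0 <= a x <= 1) ->
  measurable_fun setT h -> (forall x, 0 <= h x <= 1) ->
  measurable_fun setT h' -> (forall x, 0 <= h' x <= 1) ->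
  (forall x, t < a x -> h' x = 1) -> (forall x, a x < t -> h' x = 0) ->
  \int[P]_x h x = \int[P]_x h' x ->
  \int[P]_x (a x * h x) <= \int[P]_x (a x * h' x).
Proof.
move=> ma a01 mh h01 mh' h'01 h'1 h'0 hh'.
have iah := integrable01M P ma a01 mh h01.
have iah' := integrable01M P ma a01 mh' h'01.
have [ih ih'] := (integrable01 P mh h01, integrable01 P mh' h'01).
have [ith ith'] := (integrable_scale t ih, integrable_scale t ih').
rewrite -(lerD2r (t * \int[P]_x h' x)) -[in leRHS]hh' -!RintegralZl//.
rewrite -!RintegralD//; apply: le_Rintegral => //.
- exact: integrable_add.
- exact: integrable_add.
move=> x _; have := h01 x; have := a01 x.
case: (ltgtP (a x) t) => [/[dup] /h'0 ->|/[dup] /h'1 ->|->]; nra.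
Qed.

End thresholds.

(** * Classifiers and their mean functions *)

Section classifiers.
Context {d : measure_display} {X : measurableType d} {R : realType}.
Implicit Type Y : stochastic_classifier X R.

Definition mean_label Y (x : X) : R :=
  fine 'E_(sc_prob Y)[fun w => (Y x w)%:R].

Lemma measurable_label Y x :
  measurable_fun setT (fun w => (Y x w)%:R : R).
Proof.
rewrite (_ : (fun _ => _) = fun w => if Y x w then 1 else 0); last first.
  by apply/funext => w; case: (Y x w).
exact: measurable_fun_ifT.
Qed.

Lemma label01 Y x w : 0 <= ((Y x w)%:R : R) <= 1.
Proof. by case: (Y x w); rewrite lexx ler01. Qed.

Lemma integrable_label Y x :
  (sc_prob Y).-integrable setT (EFin \o (fun w => (Y x w)%:R : R)).
Proof.
by apply: integrable01; [exact: measurable_label|exact: label01].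
Qed.

Lemma mean_label01 Y x : 0 <= mean_label Y x <= 1.
Proof.
rewrite /mean_label fine_expectationE; apply: Rintegral01.
  exact: measurable_label.
exact: label01.
Qed.

Lemma classifier_expectation_label (P : probability (X * bool)%type R) Y
    (a : X -> R) :
  classifier_expectation P Y (fun x y => a x * y) =
  \int[P]_z (a z.1 * mean_label Y z.1).
Proof.
rewrite /classifier_expectation fine_expectationE; apply: eq_Rintegral => z _.
rewrite /mean_label !fine_expectationE RintegralZl//.
exact: integrable_label.
Qed.

Lemma classifier_expectation_complement (P : probability (X * bool)%type R) Y
    (a : X -> R) :
  classifier_expectation P Y (fun x y => a x * (1 - y)) =
  \int[P]_z (a z.1 * (1 - mean_label Y z.1)).
Proof.
rewrite /classifier_expectation fine_expectationE; apply: eq_Rintegral => z _.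
have i1 : (sc_prob Y).-integrable setT (EFin \o (fun=> 1 : R)).
  by apply: integrable01 => // w; rewrite lexx ler01.
rewrite fine_expectationE RintegralZl ?RintegralB//.
- rewrite Rintegral_cst_probability.
  by rewrite /mean_label fine_expectationE.
- exact: integrable_label.
- apply: integrable01.
    by apply: measurable_funB => //; exact: measurable_label.
  by move=> w; have /andP[] := label01 z.1 w; lra.
Qed.

Lemma confusion_of_mean (P : probability (X * bool)%type R) (a : X -> R) Y :
  confusion_of P a Y =
  confusion_mx (\int[P]_z ((1 - a z.1) * (1 - mean_label Y z.1)))
    (\int[P]_z ((1 - a z.1) * mean_label Y z.1))
    (\int[P]_z (a z.1 * (1 - mean_label Y z.1)))
    (\int[P]_z (a z.1 * mean_label Y z.1)).
Proof.
rewrite /confusion_of.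
by rewrite !(classifier_expectation_label, classifier_expectation_complement).
Qed.

(** All points share a single biased coin w, of probability p of heads: only
    the law of each label matters, not their joint law, and w is consulted only
    where eta = t. *)
Definition threshold_label (t : R) (eta : X -> R) (x : X) : bool -> bool :=
  fun w => (t < eta x) || ((eta x == t) && w).

Lemma measurable_threshold_label t eta x :
  measurable_fun setT (threshold_label t eta x).
Proof. by []. Qed.

Lemma threshold_classifier (p t : R) (eta : X -> R) :
  0 <= p <= 1 -> 0 <= t <= 1 ->
  measurable_fun setT eta -> (forall x, 0 <= eta x <= 1) ->
  exists2 Y, is_RTC Y &
    forall x, mean_label Y x = p * (eta x == t)%:R + (t < eta x)%R%:R.
Proof.
move=> p01 t01 meta eta01.
pose coin : probability bool R := bernoulli_prob p.
pose L x : {RV coin >-> bool} :=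
  mfun_Sub (mem_set (measurable_threshold_label t eta x)).
have EL x : fine 'E_coin[fun w => (L x w)%:R] =
    p * (eta x == t)%:R + (t < eta x)%R%:R.
  rewrite unlock integral_bernoulli_prob//= /threshold_label.
  by case: (ltgtP (eta x) t) => _ /=; rewrite /unstable.onem; ring.
have mL : measurable_fun setT (fun x => fine 'E_coin[fun w => (L x w)%:R]).
  rewrite (_ : (fun _ => _) =
      fun x => if t < eta x then 1 else if eta x == t then p else 0).
    apply: measurable_fun_ifT => //; first exact: measurable_fun_ltr.
    by apply: measurable_fun_ifT => //; exact: measurable_fun_eqr.
  apply/funext => y; rewrite EL.
  by case: (ltgtP (eta y) t) => _ /=; ring.
exists (StochasticClassifier mL); last exact: EL.
exists p, t, eta; split => // x.
apply: eq_bernoulli.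
transitivity (bernoulli_prob p (L x @^-1` [set true])) => //.
rewrite bernoulli_probE// !diracE.
have memL b : (b \in L x @^-1` [set true]) = threshold_label t eta x b.
  by apply/idP/idP; rewrite inE.
rewrite !memL /threshold_label -!EFinM -EFinD /unstable.onem; congr EFin.
by case: (ltgtP (eta x) t) => _ /=; ring.
Qed.

End classifiers.

(** * Thresholding improves every confusion matrix measure *)

(** With the row sums fixed, a larger TP and a smaller FP amount to moving
    e1 = FP - FP' and e2 = TP' - TP onto the diagonal. *)
Lemma CMM_le (R : realType) (M : 'M[R]_2 -> R)
    (TN FP FN TP TN' FP' FN' TP' : R) :
  CMM M -> 0 <= TN -> 0 <= FP' -> 0 <= FN' -> 0 <= TP ->
  TN + FP + FN + TP = 1 ->
  TN' + FP' = TN + FP -> TP' + FN' = TP + FN -> TP <= TP' -> FP' <= FP ->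
  M (confusion_mx TN FP FN TP) <= M (confusion_mx TN' FP' FN' TP').
Proof.
move=> hM TN0 FP'0 FN'0 TP0 sum1 neg pos leTP leFP.
have -> : TN' = TN + (FP - FP') by lra.
have {2}-> : FP' = FP - (FP - FP') by lra.
have -> : FN' = FN - (TP' - TP) by lra.
have {2}-> : TP' = TP + (TP' - TP) by lra.
apply: hM; [split|lra|lra].
  by move=> i j; rewrite mxE; case: ifP => _; case: ifP => _; lra.
by rewrite !mxE.
Qed.

(** The comparison classifier thresholds [a] itself at the rate of positive
    predictions of [Y]; it is built before the measure M is given. *)
Lemma threshold_dominates (d : measure_display) (X : measurableType d)
    (R : realType) (P : probability (X * bool)%type R) (a : X -> R)
    (Y : stochastic_classifier X R) :
  measurable_fun setT a -> (forall x, 0 <= a x <= 1) ->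
  exists2 Y' : stochastic_classifier X R, is_RTC Y' &
    forall M, CMM M -> M (confusion_of P a Y) <= M (confusion_of P a Y').
Proof.
move=> ma a01.
have mfst f : measurable_fun setT f ->
    measurable_fun setT (fun z : X * bool => f z.1 : R).
  by move=> mf; exact: (measurableT_comp mf measurable_fst).
have mfa := mfst _ ma.
have fa01 z : 0 <= a (z : X * bool).1 <= 1 by exact: a01.
pose h z := mean_label Y (z : X * bool).1.
have mh : measurable_fun setT h by exact: (mfst _ (sc_mean_measurable _)).
have h01 z : 0 <= h z <= 1 by exact: mean_label01.
have q01 := Rintegral01 P mh h01.
have [p [t [p01 t01 q_eq]]] := exists_threshold01 P mfa fa01 q01.
have [Y' rtc meanY'] := threshold_classifier p01 t01 ma a01.
exists Y' => // M hM.
pose h' z := mean_label Y' (z : X * bool).1.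
have mh' : measurable_fun setT h' by exact: (mfst _ (sc_mean_measurable _)).
have h'01 z : 0 <= h' z <= 1 by exact: mean_label01.
have hh' : \int[P]_z h z = \int[P]_z h' z.
  by rewrite -q_eq; apply: eq_Rintegral => z _; rewrite /h' meanY'.
have np : \int[P]_z (a z.1 * h z) <= \int[P]_z (a z.1 * h' z).
  apply: (neyman_pearson (t := t)) => //.
  - move=> z tz; rewrite /h' meanY' tz; move: tz.
    by case: (ltgtP (a z.1) t) => //= _ _; ring.
  - move=> z tz; rewrite /h' meanY'; move: tz.
    by case: (ltgtP (a z.1) t) => //= _ _; ring.
have mC (k : X * bool -> R) : measurable_fun setT k ->
    measurable_fun setT (fun z => 1 - k z).
  by move=> mk; exact: measurable_funB.
have C01 (k : X * bool -> R) : (forall z, 0 <= k z <= 1) ->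
    forall z, 0 <= 1 - k z <= 1.
  by move=> k01 z; have := k01 z; lra.
have rowsum (b k : X * bool -> R) : measurable_fun setT b ->
    (forall z, 0 <= b z <= 1) -> measurable_fun setT k ->
    (forall z, 0 <= k z <= 1) ->
    \int[P]_z (b z * k z) + \int[P]_z (b z * (1 - k z)) = \int[P]_z b z.
  move=> mb b01 mk k01; rewrite -(Rintegral_mul_complement P mk k01 mb b01).
  by congr (_ + _); apply: eq_Rintegral => z _; ring.
have ge0 (b k : X * bool -> R) : (forall z, 0 <= b z <= 1) ->
    (forall z, 0 <= k z <= 1) -> 0 <= \int[P]_z (b z * k z).
  move=> b01 k01; apply: Rintegral_ge0 => z _.
  by have := b01 z; have := k01 z; nra.
have := Rintegral_mul_complement P mfa fa01 mh h01.
have := Rintegral_mul_complement P mfa fa01 mh' h'01.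
rewrite -hh'.
have := rowsum _ _ mfa fa01 mh h01; have := rowsum _ _ mfa fa01 mh' h'01.
have := rowsum _ _ (mC _ mfa) (C01 _ fa01) mh h01.
have := rowsum _ _ (mC _ mfa) (C01 _ fa01) mh' h'01.
have : \int[P]_z (1 - a z.1) + \int[P]_z (a z.1) = 1.
  rewrite -RintegralD//; last 2 first.
  - exact: (integrable01 P (mC _ mfa) (C01 _ fa01)).
  - exact: (integrable01 P mfa fa01).
  rewrite -[RHS](Rintegral_cst_probability P 1).
  by apply: eq_Rintegral => z _; ring.
move=> total neg' neg pos' pos rate' rate.
rewrite !confusion_of_mean; apply: CMM_le => //; rewrite -/h -/h'.
- exact: ge0 (C01 _ fa01) (C01 _ h01).
- exact: ge0 (C01 _ fa01) h'01.
- exact: ge0 fa01 (C01 _ h'01).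
- exact: ge0 fa01 h01.
all: rewrite /h /h' in np neg' neg pos' pos rate' rate *; lra.
Qed.

Theorem theorem3 (R : realType) (X : pointedMetricType R) (hX : separable X)
    (P : probability (borel X * bool)%type R)
    (etastar : borel X -> R) (hetastar : regression_function P etastar)
    (M : 'M[R]_2 -> R) (hM : CMM M) :
  (forall Yhat : stochastic_classifier (borel X) R,
     exists2 Yrtc : stochastic_classifier (borel X) R,
       is_RTC Yrtc &
       M (confusion_of P etastar Yrtc) >= M (confusion_of P etastar Yhat)) /\
  ((exists Ymax : stochastic_classifier (borel X) R,
      forall Yhat : stochastic_classifier (borel X) R,
        M (confusion_of P etastar Yhat) <= M (confusion_of P etastar Ymax)) ->
   exists2 Yrtc : stochastic_classifier (borel X) R,
     is_RTC Yrtc &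
     forall Yhat : stochastic_classifier (borel X) R,
       M (confusion_of P etastar Yhat) <= M (confusion_of P etastar Yrtc)).
Proof.
have [meta eta01 _] := hetastar.
have improve := fun Y => threshold_dominates P Y meta eta01.
split=> [Yhat|[Ymax Ymax_max]].
  by have [Yrtc rtc le_rtc] := improve Yhat; exists Yrtc => //; exact: le_rtc.
have [Yrtc rtc le_rtc] := improve Ymax; exists Yrtc => // Yhat.
exact: le_trans (Ymax_max Yhat) (le_rtc M hM).
Qed.
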